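(* Let $Q$ be a loop. The following identities (each required for all $x,y,z\in Q$) are equivalent: (1) $\bigl((x(yx))/x\bigr)(zx)=x((yz)x)$; (2) $\bigl(x((yx^\lambda)x)\bigr)(zx)=x((yz)x)$; (3) $(x^\lambda\backslash y)(zx)=x((yz)x)$; (4) $(xy)\bigl(x\backslash((xz)x)\bigr)=(x(yz))x$; (5) $(xy)\bigl((x(x^\rho z))x\bigr)=(x(yz))x$; (6) $(xy)(z/x^\rho)=(x(yz))x$; (7) $x^\lambda\backslash\bigl((x^\lambda y)z\bigr)=\bigl(y(zx)\bigr)/x$; (8) $x\backslash\bigl((xy)z\bigr)=\bigl(y(zx^\rho)\bigr)/x^\rho$.
   Context: In a loop $Q$ with unit $1$, $a\backslash b$ denotes the unique $u$ with $au=b$, and $b/a$ denotes the unique $v$ with $va=b$. Further $x^\lambda=1/x$ and $x^\rho=x\backslash 1$, so $x^\lambda x=1=xx^\rho$. *)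

(* Defs.v *)
From HB Require Import structures.
From mathcomp Require Import all_boot.

Set Implicit Arguments.
Unset Strict Implicit.
Unset Printing Implicit Defensive.

Declare Scope loop_scope.
Delimit Scope loop_scope with loop.
Local Open Scope group_scope.

(* The unit laws are stated here rather than inherited from [UMagma] because
   [UMagma] requires a choiceType, while loops are over an arbitrary type. *)
HB.mixin Record BaseUMagma_isLoop Q of BaseUMagma Q := {
  loop_mul1l : forall a : Q, 1 * a = a;
  loop_mul1r : forall a : Q, a * 1 = a;
  ldiv : Q -> Q -> Q;
  rdiv : Q -> Q -> Q;
  ldivP : forall a b u : Q, a * u = b <-> u = ldiv a b;
  rdivP : forall b a v : Q, v * a = b <-> v = rdiv b a
}.

#[short(type="loopType")]
HB.structure Definition Loop := {Q of BaseUMagma_isLoop Q & BaseUMagma Q}.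

(* [mul] has its arguments in [group_scope], where [b / a] is [b * a^-1]; the
   explicit [%loop] make the divisions below nest inside products. *)
Notation "a * b" := (mul a%loop b%loop) : loop_scope.
Notation "a \ b" := (ldiv a%loop b%loop) (at level 50) : loop_scope.
Notation "b / a" := (rdiv b%loop a%loop) : loop_scope.
Notation "1" := (@one _) : loop_scope.

Definition linv (Q : loopType) (x : Q) : Q := (1 / x)%loop.
Definition rinv (Q : loopType) (x : Q) : Q := (x \ 1)%loop.

Notation "x ^λ" := (linv x%loop)
  (at level 1, left associativity, format "x ^λ") : loop_scope.
Notation "x ^ρ" := (rinv x%loop)
  (at level 1, left associativity, format "x ^ρ") : loop_scope.

(* Main.v *)
Require Import Defs.
From HB Require Import structures.
From mathcomp Require Import all_boot.

(** The identities (1), (2), (3) and (7) all come down to one fact: for every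
    [x], the inverse of left multiplication by [x^λ], right multiplication by
    [x], and [w |-> x * (w * x)] form an autotopism of the loop.  This is (3) as
    it stands.  In (1) and (2) the first component is another expression
    [theta y]; the case [y = x^λ] forces [theta (x^λ * w) = w], so [theta] is
    the inverse of left multiplication by [x^λ] after all
    ([product_inverse]).  In (7), after replacing [y] by [x^λ \ y], the third
    component is [(x^λ \ w) * x], and the case [y = x] of (7) shows that this
    is [x * (w * x)].  Such specializations pass from each of the four
    forms to the next, in a cycle.

    The identities (4), (5), (6) and (8) are the same four read in the opposite
    loop, where products, divisions and inverses are reversed; hence they are
    also equivalent to each other, with no new computation.

    The two families meet because [x |-> x^λ] and [x |-> x^ρ] are mutually
    inverse bijections: writing [x^ρ] for [x] turns (7) into (8), and writing
    [x^λ] for [x] turns (8) into (7). *)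

Local Open Scope loop_scope.

Lemma mul_ldiv (Q : loopType) (a b : Q) : a * (a \ b) = b.
Proof. by apply/ldivP. Qed.

Lemma ldiv_mul (Q : loopType) (a b : Q) : a \ (a * b) = b.
Proof. by symmetry; apply/ldivP. Qed.

Lemma rdiv_mul (Q : loopType) (a b : Q) : (b / a) * a = b.
Proof. by apply/rdivP. Qed.

Lemma mul_rdiv (Q : loopType) (a b : Q) : (b * a) / a = b.
Proof. by symmetry; apply/rdivP. Qed.

Lemma mul_linv (Q : loopType) (x : Q) : x^λ * x = 1.
Proof. exact: rdiv_mul. Qed.

Lemma mul_rinv (Q : loopType) (x : Q) : x * x^ρ = 1.
Proof. exact: mul_ldiv. Qed.

Lemma rinvK (Q : loopType) (x : Q) : x^ρ^λ = x.
Proof. by symmetry; apply/rdivP; rewrite mul_rinv. Qed.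

Lemma linvK (Q : loopType) (x : Q) : x^λ^ρ = x.
Proof. by symmetry; apply/ldivP; rewrite mul_linv. Qed.

Definition quotient_law (Q : loopType) := forall x y z : Q,
  ((x * (y * x)) / x) * (z * x) = x * ((y * z) * x).

Definition product_law (Q : loopType) := forall x y z : Q,
  (x * ((y * x^λ) * x)) * (z * x) = x * ((y * z) * x).

Definition inverse_law (Q : loopType) := forall x y z : Q,
  (x^λ \ y) * (z * x) = x * ((y * z) * x).

Definition translation_law (Q : loopType) := forall x y z : Q,
  x^λ \ ((x^λ * y) * z) = (y * (z * x)) / x.

(** At [z = x^λ] the factor [z * x] disappears, which expresses the quotient
    as a product. *)
Lemma quotient_product (Q : loopType) : quotient_law Q -> product_law Q.
Proof.
move=> H x y z.
by have := H x y x^λ; rewrite mul_linv loop_mul1r => <-; apply: H.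
Qed.

(** Call [theta w] the left factor.  Taking [z = 1] gives
    [theta w * x = x * (w * x)], hence [theta (x^λ) = 1]; the law at [y = x^λ]
    then yields [theta (x^λ * w) = w], so [theta] is division by [x^λ]. *)
Lemma product_inverse (Q : loopType) : product_law Q -> inverse_law Q.
Proof.
move=> H x y z.
have theta_eq w : x * ((w * x^λ) * x) = (x * (w * x)) / x.
  by have := H x w 1; rewrite loop_mul1l loop_mul1r => /rdivP.
have theta_linv w : (x * ((x^λ * w) * x)) / x = w.
  have := H x x^λ w; rewrite theta_eq mul_linv loop_mul1r.
  by rewrite -{1}[x](loop_mul1l x) mul_rdiv loop_mul1l => <-; rewrite mul_rdiv.
by rewrite -H theta_eq -[y in RHS](mul_ldiv _ x^λ) theta_linv.
Qed.

(** The product [x * (w * x)] is [(x^λ \ w) * x], by [z = 1]; cancelling the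
    final [x] and replacing [y] by [x^λ * y] gives the result. *)
Lemma inverse_translation (Q : loopType) : inverse_law Q -> translation_law Q.
Proof.
move=> H x y z; apply/rdivP.
have swap w : (x^λ \ w) * x = x * (w * x).
  by have := H x w 1; rewrite loop_mul1l loop_mul1r.
by rewrite swap -H ldiv_mul.
Qed.

(** The case [y = x], where [x^λ * y = 1], gives
    [(x^λ \ w) * x = x * (w * x)].  This turns both the quotient and the right
    side of the goal into divisions by [x^λ], and what remains is the law at
    [x^λ \ y]. *)
Lemma translation_quotient (Q : loopType) : translation_law Q -> quotient_law Q.
Proof.
move=> H x y z.
have swap w : (x^λ \ w) * x = x * (w * x).
  by have := H x x w; rewrite mul_linv loop_mul1l => /rdivP.
rewrite -!swap mul_rdiv.
by have /rdivP := H x (x^λ \ y) z; rewrite mul_ldiv.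
Qed.

(** An alias of the carrier, so that it can carry the reversed product. *)
Definition opposite (Q : loopType) : Type := Q.

HB.instance Definition _ (Q : loopType) :=
  hasMul.Build (opposite Q) (fun a b : Q => b * a).

HB.instance Definition _ (Q : loopType) :=
  hasOne.Build (opposite Q) (1 : Q).

HB.instance Definition _ (Q : loopType) :=
  BaseUMagma_isLoop.Build (opposite Q)
    (@loop_mul1r Q) (@loop_mul1l Q)
    (fun a b u => @rdivP Q b a u) (fun b a v => @ldivP Q a b v).

(** In the opposite loop the law at [x] is the original law at [x^ρ], up to
    exchanging the sides of the equation and the variables [y] and [z]; and
    [x^ρ] ranges over the whole loop, because [x = x^λ^ρ]. *)
Lemma translation_opposite (Q : loopType) :
  translation_law Q <-> translation_law (opposite Q).
Proof.
split=> H x y z.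
  by have := H (rinv (x : Q)) z y; rewrite rinvK.
have dual (u v w : Q) : (v * (w * u^ρ)) / u^ρ = u \ ((u * v) * w).
  exact: (H u w v).
by rewrite -dual linvK.
Qed.

Theorem theorem3p3 (Q : loopType) :
  [<-> forall x y z : Q, ((x * (y * x)) / x) * (z * x) = x * ((y * z) * x);
       forall x y z : Q, (x * ((y * x^λ) * x)) * (z * x) = x * ((y * z) * x);
       forall x y z : Q, (x^λ \ y) * (z * x) = x * ((y * z) * x);
       forall x y z : Q, (x * y) * (x \ ((x * z) * x)) = (x * (y * z)) * x;
       forall x y z : Q, (x * y) * ((x * (x^ρ * z)) * x) = (x * (y * z)) * x;
       forall x y z : Q, (x * y) * (z / x^ρ) = (x * (y * z)) * x;
       forall x y z : Q, x^λ \ ((x^λ * y) * z) = (y * (z * x)) / x;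
       forall x y z : Q, x \ ((x * y) * z) = (y * (z * x^ρ)) / x^ρ].
Proof.
(* Read in the opposite loop, an identity of the first family becomes one of the
   second with y and z exchanged, whence the calls at x z y. *)
tfae.
- exact: quotient_product.
- exact: product_inverse.
- move=> /inverse_translation/translation_opposite/translation_quotient H x y z.
  exact: (H x z y).
- move=> H x y z.
  have K : quotient_law (opposite Q) by move=> u v w; apply: (H u w v).
  exact: (quotient_product _ K x z y).
- move=> H x y z.
  have K : product_law (opposite Q) by move=> u v w; apply: (H u w v).
  exact: (product_inverse _ K x z y).
- move=> H; apply/translation_opposite/inverse_translation => x y z.
  exact: (H x z y).
- by move=> H x y z; have := H x^ρ y z; rewrite rinvK.
- move=> H; apply: translation_quotient => x y z.
  by have := H x^λ y z; rewrite linvK.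
Qed.
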